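(* Let $[X,d,m]$ be a metric random walk space with invariant and reversible probability measure $\nu$, and assume $\Delta_m$ is ergodic. Then $${\rm gap}(-\Delta_m)=\sup\Big\{\lambda\ge0:\ \lambda\,\mathcal H_m(f)\le\int_X(-\Delta_m f)^2\,d\nu\ \ \text{for all } f\in L^2(X,\nu)\Big\}.$$
   Context: A metric random walk space $[X,d,m]$ is a Polish metric space $(X,d)$ with a family $m=(m_x)_{x\in X}$ of Borel probability measures, $x\mapsto m_x(A)$ Borel measurable, each with finite first moment. A Radon measure $\nu$ is invariant if $\nu(A)=\int_X m_x(A)d\nu(x)$ for all $\nu$-measurable $A$, reversible if $dm_x(y)d\nu(x)=dm_y(x)d\nu(y)$. $\Delta_m f(x)=\int_X(f(y)-f(x))dm_x(y)$; $\Delta_m$ is ergodic if $\Delta_m u=0$ implies $u$ is $\nu$-a.e. constant. $\mathcal H_m(f)=\frac12\iint(f(y)-f(x))^2dm_x(y)d\nu(x)$; ${\rm Var}_\nu(f)=\int_X(f-\int fd\nu)^2d\nu$; ${\rm gap}(-\Delta_m)=\inf\{\mathcal H_m(f)/{\rm Var}_\nu(f): f\in L^2(X,\nu),\ {\rm Var}_\nu(f)\ne0\}$. *)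

(* Defs.v *)
From HB Require Import structures.
From mathcomp Require Import all_boot all_order all_algebra.
From mathcomp Require Import all_classical all_reals all_analysis.
From mathcomp Require Import measurable_realfun.
Set Implicit Arguments. Unset Strict Implicit. Unset Printing Implicit Defensive.
Import Order.TTheory GRing.Theory Num.Theory.
Local Open Scope classical_set_scope.
Local Open Scope ring_scope.

Section MRWS.
Context {R : realType} {dd : measure_display} {X : measurableType dd}.

Definition is_metric (dist : X -> X -> R) : Prop :=
  (forall x y, dist x y = 0 <-> x = y) /\
  (forall x y, dist x y = dist y x) /\
  (forall x y z, dist x z <= dist x y + dist y z).

Definition dopen (dist : X -> X -> R) (U : set X) : Prop :=
  forall x, U x -> exists2 e : R, 0 < e & [set y | dist x y < e] `<=` U.

Definition dcomplete (dist : X -> X -> R) : Prop :=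
  forall u : nat -> X,
    (forall e : R, 0 < e -> exists N, forall p q, (N <= p)%N -> (N <= q)%N ->
        dist (u p) (u q) < e) ->
    exists l : X, forall e : R, 0 < e -> exists N, forall p, (N <= p)%N ->
        dist (u p) l < e.

Definition dseparable (dist : X -> X -> R) : Prop :=
  exists s : nat -> X, forall x (e : R), 0 < e -> exists n, dist x (s n) < e.

Definition polish_metric (dist : X -> X -> R) : Prop :=
  [/\ is_metric dist, dcomplete dist & dseparable dist].

Definition borel_for (dist : X -> X -> R) : Prop :=
  (@measurable dd X) = <<s dopen dist >>.

Definition metric_random_walk_space (dist : X -> X -> R)
    (m : X -> probability X R) : Prop :=
  [/\ polish_metric dist, borel_for dist,
      (forall A, measurable A -> measurable_fun [set: X] (fun x => (m x A : \bar R))) &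
      (forall x, (\int[m x]_y (dist x y)%:E < +oo)%E)].

Definition invariant_measure (m : X -> probability X R) (nu : probability X R) :=
  forall A, measurable A -> nu A = (\int[nu]_x m x A)%E.

Definition reversible_measure (m : X -> probability X R) (nu : probability X R) :=
  forall A B, measurable A -> measurable B ->
    (\int[nu]_(x in A) m x B = \int[nu]_(y in B) m y A)%E.

(** L^2(X, nu) (Borel representatives) *)
Definition L2 (nu : probability X R) (f : X -> R) : Prop :=
  measurable_fun setT f /\ (\int[nu]_x ((f x) ^+ 2)%:E < +oo)%E.

Definition lapm (m : X -> probability X R) (f : X -> R) (x : X) : R :=
  fine (\int[m x]_y (f y - f x)%:E).

Definition ergodic (m : X -> probability X R) (nu : probability X R) : Prop :=
  forall u, L2 nu u -> {ae nu, forall x, lapm m u x = 0} ->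
    exists c : R, {ae nu, forall x, u x = c}.

Definition Hm (m : X -> probability X R) (nu : probability X R) (f : X -> R)
  : \bar R :=
  ((2^-1)%:E * \int[nu]_x \int[m x]_y ((f y - f x) ^+ 2)%:E)%E.

Definition mean (nu : probability X R) (f : X -> R) : R :=
  fine (\int[nu]_x (f x)%:E).

Definition Var (nu : probability X R) (f : X -> R) : \bar R :=
  (\int[nu]_x ((f x - mean nu f) ^+ 2)%:E)%E.

Definition gap (m : X -> probability X R) (nu : probability X R) : \bar R :=
  ereal_inf [set (Hm m nu f * ((fine (Var nu f))^-1)%:E)%E
            | f in [set f | L2 nu f /\ Var nu f <> 0%E]].

End MRWS.

(* Main.v *)
Require Import Defs.
From HB Require Import structures.
From mathcomp Require Import all_boot all_order all_algebra.
From mathcomp Require Import all_classical all_reals all_analysis.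
From mathcomp Require Import measurable_realfun giry.
From mathcomp Require Import ring lra.
Import Order.TTheory GRing.Theory Num.Theory.
Import numFieldNormedType.Exports.
Local Open Scope classical_set_scope.
Local Open Scope ring_scope.

(** Write [A = - lapm m], a symmetric operator on [L2 nu] with [H_m f = <A f, f>]
    and [0 <= A^2 <= 2 A]; for [l >= 0] it suffices to show that the Poincaré
    inequality [l Var f <= <A f, f>] is equivalent to [l <A f, f> <= |A f|^2].
    The direct implication is Cauchy-Schwarz applied to [<A f, f - mean f>].
    Conversely, the second inequality gives [A^3 >= l A^2], that is, the Poincaré
    inequality on the range of [A].  For [w] of mean zero the iterates [f_n] of
    [1 - A / 2] at [w] have geometrically decaying increments, so they converge
    in [L2]; their limit lies in the kernel of [A] and has mean zero, hence
    vanishes by ergodicity.  Since [w - f_n] lies in the range of [A], the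
    inequality passes to [w]. *)

(** * Symmetric operators on a semi-inner product space *)

Section semi_inner_product.
Context {R : realType} {V : lmodType R}.
Variable ip : V -> V -> R.
Hypothesis ipC : forall u v, ip u v = ip v u.
Hypothesis ipZDl : forall a u v w, ip (a *: u + v) w = a * ip u w + ip v w.
Hypothesis ip_ge0 : forall u, 0 <= ip u u.

Lemma ipDl u v w : ip (u + v) w = ip u w + ip v w.
Proof. by rewrite -[u in LHS]scale1r ipZDl mul1r. Qed.

Lemma ip0l w : ip 0 w = 0.
Proof. by have := ipDl 0 0 w; rewrite addr0; lra. Qed.

Lemma ipZl a u w : ip (a *: u) w = a * ip u w.
Proof. by rewrite -[a *: u]addr0 ipZDl ip0l addr0. Qed.

Lemma ipBl u v w : ip (u - v) w = ip u w - ip v w.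
Proof. by rewrite -scaleN1r ipDl ipZl mulN1r. Qed.

Lemma ipBr u v w : ip w (u - v) = ip w u - ip w v.
Proof. by rewrite !(ipC w) ipBl. Qed.

Lemma ipZr a u w : ip w (a *: u) = a * ip w u.
Proof. by rewrite !(ipC w) ipZl. Qed.

Lemma ip_sub u v : ip (u - v) (u - v) = ip u u - 2 * ip u v + ip v v.
Proof. by rewrite ipBl !ipBr (ipC v u); ring. Qed.

Lemma ip_add u v : ip (u + v) (u + v) = ip u u + 2 * ip u v + ip v v.
Proof. by rewrite ipDl !(ipC _ (u + v)) !ipDl (ipC v u); ring. Qed.

Lemma ip_subZ a u v :
  ip (u - a *: v) (u - a *: v) = ip u u - 2 * a * ip u v + a ^+ 2 * ip v v.
Proof. by rewrite ip_sub !(ipZl, ipZr); ring. Qed.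

Lemma ip_young a u v : 0 < a -> 2 * ip u v <= a * ip u u + ip v v / a.
Proof.
move=> a0; have := ip_ge0 (a *: u - v); rewrite ip_sub !(ipZl, ipZr) => h.
rewrite -(ler_pM2r a0) [leRHS]mulrDl divfK ?gt_eqF//; lra.
Qed.

Lemma ip_cauchy_schwarz u v : ip u v ^+ 2 <= ip u u * ip v v.
Proof.
have := ip_ge0 u; rewrite le_eqVlt => /predU1P[u0|u0].
  have -> : ip u v = 0; last by rewrite -u0 mul0r expr0n.
  apply/eqP/negPn/negP => uv0.
  (* The form may be degenerate, so [u] need not vanish; with this coefficient the squared norm
     would equal [-1]. *)
  have := ip_ge0 (v - ((1 + ip v v) / (2 * ip u v)) *: u).
  rewrite ip_subZ -u0 mulr0 addr0 (ipC v u).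
  have -> : 2 * ((1 + ip v v) / (2 * ip u v)) * ip u v = 1 + ip v v by field.
  lra.
have := ip_ge0 (v - (ip u v / ip u u) *: u); rewrite ip_subZ (ipC v u) => h.
rewrite -(ler_pM2l (_ : 0 < (ip u u)^-1)) ?invr_gt0// mulKf ?gt_eqF//.
rewrite -subr_ge0; apply: le_trans h _; rewrite le_eqVlt; apply/orP; left.
by apply/eqP; field; rewrite gt_eqF.
Qed.

(** * Symmetric operators with [A^2 <= 2 A] *)

Variable A : V -> V.
Hypothesis ipA : forall u v, ip (A u) v = ip u (A v).
Hypothesis ipAA : forall u, ip (A u) (A u) <= 2 * ip (A u) u.

Lemma ipA_ge0 u : 0 <= ip (A u) u.
Proof. have := ip_ge0 (A u); have := ipAA u; lra. Qed.

Lemma ipA_eq0 u v : ip (A u) u = 0 -> ip (A u) v = 0.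
Proof.
move=> u0; have := ipAA u; rewrite u0 mulr0 => Au.
have := ip_cauchy_schwarz (A u) v; have := ip_ge0 v; nra.
Qed.

Lemma ipAA_le u : ip (A u) (A u) <= 4 * ip u u.
Proof.
have := ip_young 2^-1 (A u) u _; rewrite invrK invr_gt0 ltr0n => /(_ isT).
have := ipAA u; lra.
Qed.

Lemma ipA_le u : ip (A u) u <= 2 * ip u u.
Proof.
have := ip_young 2^-1 (A u) u _; rewrite invrK invr_gt0 ltr0n => /(_ isT).
have := ipAA u; lra.
Qed.

(** [A] is a bare function; symmetry makes it linear when tested against any [w], that is, up to
    null vectors. *)
Lemma ipABZ u v a w : ip (A (u - a *: v)) w = ip (A u - a *: A v) w.
Proof. by rewrite ipA !ipBl !ipZl !ipA. Qed.

Lemma ipA_cauchy_schwarz u v : ip (A u) v ^+ 2 <= ip (A u) u * ip (A v) v.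
Proof.
have [u0|] := eqVneq (ip (A u) u) 0.
  by rewrite ipA_eq0// expr0n u0 mul0r.
rewrite neq_lt ltNge ipA_ge0/= => u0.
have := ipA_ge0 (v - (ip (A u) v / ip (A u) u) *: u).
rewrite ipABZ !(ipBl, ipBr, ipZl, ipZr) (ipA v u) (ipC v) => h.
rewrite -(ler_pM2l (_ : 0 < (ip (A u) u)^-1)) ?invr_gt0// mulKf ?gt_eqF//.
rewrite -subr_ge0; apply: le_trans h _; rewrite le_eqVlt; apply/orP; left.
by apply/eqP; field; rewrite gt_eqF.
Qed.

Variable e : V.
Hypothesis ipee : ip e e = 1.
Hypothesis Ae : A e = 0.

Lemma ipAe u : ip (A u) e = 0.
Proof. by rewrite ipA Ae ipC ip0l. Qed.

(** As [A u] is orthogonal to [e], [<A u, u>] is also the product of [A u] with the centred vector.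
    Cauchy-Schwarz bounds its square by [|A u|^2] times the variance, and one factor [<A u, u>]
    cancels. *)
Lemma poincare_laplacian l : 0 <= l ->
  (forall u, l * (ip u u - ip u e ^+ 2) <= ip (A u) u) ->
  forall u, l * ip (A u) u <= ip (A u) (A u).
Proof.
move=> l0 gapl u.
have [->|] := eqVneq (ip (A u) u) 0; first by rewrite mulr0 ip_ge0.
rewrite neq_lt ltNge ipA_ge0/= => u0.
have := ip_cauchy_schwarz (A u) (u - ip u e *: e).
rewrite ip_subZ ipee ipBr ipZr ipAe mulr0 subr0 => CS.
rewrite -(ler_pM2r u0) -mulrA -expr2.
apply: (le_trans (ler_wpM2l l0 CS)).
rewrite mulrCA ler_wpM2l ?ip_ge0//.
by apply: le_trans (gapl u); rewrite le_eqVlt; apply/orP; left; apply/eqP; ring.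
Qed.

(** Abstract ergodicity, followed by completeness for the geometric sequences that the iteration
    below produces. *)
Hypothesis kerA : forall u, ip (A u) (A u) = 0 ->
  exists c, ip (u - c *: e) (u - c *: e) = 0.
Hypothesis geometric_complete : forall (u : nat -> V) (C r : R), 0 < r < 1 ->
  (forall n, ip (u n - u n.+1) (u n - u n.+1) <= C * r ^+ n) ->
  exists v, ip (u n - v) (u n - v) @[n --> \oo] --> 0.

Section range.
Variable l : R.
Hypothesis l_gt0 : 0 < l.
Hypothesis laplacian_l : forall u, l * ip (A u) u <= ip (A u) (A u).

(* Cauchy-Schwarz for the form [<A u, v>], applied to [A u] and [u], turns
   [A^2 >= l A] into [A^3 >= l A^2]. *)
Lemma laplacian_range u : l * ip (A u) (A u) <= ip (A (A u)) (A u).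
Proof.
have := ipA_cauchy_schwarz (A u) u; rewrite (ipA (A u) u) => CS.
have [->|] := eqVneq (ip (A u) (A u)) 0; first by rewrite mulr0 ipA_ge0.
rewrite neq_lt ltNge ip_ge0/= => u0.
rewrite -(ler_pM2r u0) -mulrA -expr2.
apply: (le_trans (ler_wpM2l (ltW l_gt0) CS)).
by rewrite mulrCA ler_wpM2l// ipA_ge0.
Qed.

(** For [A = 1 - P], with [P] the averaging operator of the walk, this is the lazy walk
    [(1 + P) / 2]. The factor [2^-1] sends the spectrum of [A], which lies in [[0, 2]], into
    [[0, 1]]. *)
Let T u := u - 2^-1 *: A u.

Let ipAT u w : ip (A (T u)) w = ip (T (A u)) w.
Proof. exact: ipABZ. Qed.

(** The left side expands to [|A u|^2 - <A^2 u, A u> + |A^2 u|^2 / 4]. By [A^2 <= 2 A] the last term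
    is at most half the middle one, and [laplacian_range] bounds the rest. *)
Let ipAAT u : ip (A (T u)) (A (T u)) <= (1 - l / 2) * ip (A u) (A u).
Proof.
rewrite ipAT ipC ipAT /T ip_subZ.
have := laplacian_range u; have := ipAA (A u).
by rewrite (ipC (A u) (A (A u))); lra.
Qed.

(** The difference telescopes to [A] of half the sum of the earlier iterates; it is tested against
    [x] because [A] is linear only up to null vectors. *)
Let iterT_range w n :
  exists g, forall x, ip (w - iter n T w) x = ip (A g) x.
Proof.
elim: n => [|n [g gE]].
  by exists 0 => x; rewrite subrr ip0l ipA ip0l.
exists (g - (- 2^-1) *: iter n T w) => x.
rewrite ipABZ iterS {1}/T opprB addrCA. rewrite [LHS]ipDl gE.
by rewrite scaleNr opprK ipDl addrC.
Qed.

Let ip_iterT_e w n : ip (iter n T w) e = ip w e.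
Proof.
by elim: n => //= n <-; rewrite /T ipBl ipZl ipAe mulr0 subr0.
Qed.

Let iterT_cvg0 w : ip w e = 0 ->
  ip (iter n T w) (iter n T w) @[n --> \oo] --> 0.
Proof.
move=> we0.
(* [1 - l / 2] may be nonpositive; truncating [l] at 1 keeps the ratio in [[1/2, 1)]. *)
pose r := 1 - Num.min l 1 / 2.
have r01 : 0 < r < 1 by rewrite /r; case: (leP l 1) => ?; have := l_gt0; lra.
have lr : 1 - l / 2 <= r by rewrite /r; case: (leP l 1) => ?; lra.
have decay n : ip (A (iter n T w)) (A (iter n T w)) <= ip (A w) (A w) * r ^+ n.
  elim: n => [|n IHn]; first by rewrite expr0 mulr1.
  rewrite iterS; apply: le_trans (ipAAT _) _.
  rewrite exprSr mulrA; apply: le_trans (ler_wpM2r (ip_ge0 _) lr) _.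
  by rewrite mulrC ler_wpM2r//; case/andP: r01 => /ltW.
(* The increment of the iterates [f_n] is [A f_n / 2], whence the factor [4^-1]. *)
have [n|v v_lim] := geometric_complete (fun n => iter n T w)
    (4^-1 * ip (A w) (A w)) r r01.
  rewrite iterS {2 4}/T opprB addrC subrK !(ipZl, ipZr) mulrA.
  have := decay n; lra.
have Adecay : ip (A (iter n T w)) (A (iter n T w)) @[n --> \oo] --> 0.
  apply: (@squeeze_cvgr _ _ _ _ (fun=> 0) (fun n => ip (A w) (A w) * r ^+ n)).
  - by near=> n; rewrite ip_ge0 decay.
  - exact: cvg_cst.
  - rewrite -(mulr0 (ip (A w) (A w))); apply: cvgMl_tmp.
    by apply: cvg_expr; rewrite ger0_norm; case/andP: r01 => // /ltW.
(* By the parallelogram law [|A v|^2 <= 2 |A f_n|^2 + 2 |A (f_n - v)|^2], and the last term is at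
   most [8 |f_n - v|^2]; both tend to 0. *)
have Av0 : ip (A v) (A v) = 0.
  apply/eqP; rewrite eq_le ip_ge0 andbT.
  have bound : 8 * ip (iter n T w - v) (iter n T w - v)
      + 2 * ip (A (iter n T w)) (A (iter n T w))
      @[n --> \oo] --> (8 * 0 + 2 * 0 : R).
    by apply: cvgD; apply: cvgMl_tmp.
  rewrite !mulr0 addr0 in bound; apply: (cvgr_to_ge bound).
  near=> n; set f := iter n T w.
  have AvE x : ip (A v) x = ip (A f - A (f - v)) x.
    by rewrite !(ipA, ipBl) opprB addrC subrK.
  have -> : ip (A v) (A v) = ip (A f - A (f - v)) (A f - A (f - v)).
    by rewrite AvE ipC AvE.
  have := ip_ge0 (A f + A (f - v)); rewrite ip_add ip_sub.
  have := ipAA_le (f - v); lra.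
have [c vc] := kerA _ Av0.
have vce x : ip v x = c * ip e x.
  apply/eqP; rewrite -subr_eq0 -ipZl -ipBl -sqrf_eq0 eq_le sqr_ge0 andbT.
  by rewrite (le_trans (ip_cauchy_schwarz _ _))// vc mul0r.
(* [c] is [<v, e>], the limit of [<f_n, e> = <w, e> = 0]. *)
have c0 : c = 0.
  have <- : ip v e = c by rewrite vce ipee mulr1.
  apply/eqP; rewrite -sqrf_eq0 eq_le sqr_ge0 andbT.
  apply: (cvgr_to_ge v_lim); near=> n.
  have -> : ip v e = - ip (iter n T w - v) e.
    by rewrite ipBl ip_iterT_e we0; ring.
  by rewrite sqrrN (le_trans (ip_cauchy_schwarz _ _))// ipee mulr1.
apply: cvg_trans v_lim; apply: near_eq_cvg; near=> n.
by rewrite ip_sub (ipC _ v) !vce c0; ring.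
Unshelve. all: by end_near. Qed.

(* The iterates [f_n] of [1 - A / 2] satisfy [w - f_n] in the range of [A], where
   the inequality is [laplacian_range], and [f_n] tends to [0]. *)
Lemma laplacian_poincare_centered w : ip w e = 0 -> l * ip w w <= ip (A w) w.
Proof.
move=> we0; have fn0 := iterT_cvg0 w we0.
pose x := l *: w - A w.
apply/ler_addgt0Pr => eps eps0.
(* Expanding the range inequality at [w - f] leaves an error of at most [2 <x, f> + <A f, f>], hence
   of at most [d |x|^2 + |f|^2 / d + 2 |f|^2]. With [|f|^2] below [d] and [d^2] this is at most
   [d (|x|^2 + 3) = eps]. *)
pose d := eps / (ip x x + 3).
have x3 : 0 < ip x x + 3 by have := ip_ge0 x; lra.
have d0 : 0 < d by rewrite divr_gt0.
have [n fnd] : exists n, ip (iter n T w) (iter n T w) < Num.min d (d ^+ 2).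
  have /cvgr_lt /(_ (Num.min d (d ^+ 2))) := fn0.
  rewrite lt_min d0 exprn_gt0// => /(_ isT) [n _ nP].
  by exists n; apply: nP => /=.
move: fnd; rewrite lt_min; set f := iter n T w => /andP[fd fd2].
have [g gE] := iterT_range w n.
rewrite -/f in gE.
have := laplacian_range g.
have -> : ip (A g) (A g) = ip (w - f) (w - f) by rewrite -gE ipC -gE.
have -> : ip (A (A g)) (A g) = ip (A (w - f)) (w - f).
  by rewrite ipA -gE -ipA ipC -gE ipC.
have -> : ip (A (w - f)) (w - f) = ip (A w) w - 2 * ip (A w) f + ip (A f) f.
  have := ipABZ w f 1 (w - f); rewrite !scale1r => ->.
  by rewrite !(ipBl, ipBr) (ipA f w) (ipC f (A w)); ring.
rewrite ip_sub => range_f.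
have := ip_young d x f d0; have := ipA_le f.
have : ip f f / d <= d by rewrite ler_pdivrMr// -expr2 ltW.
have : d * (ip x x + 3) = eps by rewrite divfK// gt_eqF.
have := mulr_ge0 (ltW l_gt0) (ip_ge0 f).
rewrite [ip x f]ipBl ipZl; nra.
Qed.

End range.
Lemma laplacian_poincare l : 0 <= l ->
  (forall u, l * ip (A u) u <= ip (A u) (A u)) ->
  forall u, l * (ip u u - ip u e ^+ 2) <= ip (A u) u.
Proof.
rewrite le_eqVlt => /predU1P[<- _ u|l0 lA u]; first by rewrite mul0r ipA_ge0.
pose w := u - ip u e *: e.
have we0 : ip w e = 0 by rewrite ipBl ipZl ipee mulr1 subrr.
have := laplacian_poincare_centered _ l0 lA w we0.
rewrite ip_subZ ipee ipABZ Ae scaler0 subr0 ipBr ipZr ipAe mulr0 subr0.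
by apply: le_trans; rewrite le_eqVlt; apply/orP; left; apply/eqP; ring.
Qed.

End semi_inner_product.

(** * The law of one step of the walk *)

Section joint_law.
Context {R : realType} {d : measure_display} {X : measurableType d}.
Variables (m : X -> probability X R) (nu : probability X R).
Hypothesis m_measurable : forall A, measurable A ->
  measurable_fun [set: X] (fun x => (m x A : \bar R)).

Let k (x : X) : {measure set X -> \bar R} := m x.
HB.instance Definition _ := isKernel.Build _ _ X X R k m_measurable.
Let kT x : k x setT = 1%E. Proof. exact: probability_setT. Qed.
HB.instance Definition _ := Kernel_isProbability.Build _ _ X X R k kT.

Let edge (x : X) : giry (X * X)%type R :=
  giry_map (pair1_measurable x) (m x : subprobability X R).

Let measurable_edge : measurable_fun [set: X] edge.
Proof.
apply: measurable_giry_codensity => // B mB.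
have : measurable_fun setT (fun x => k x (xsection B x)).
  by apply: measurable_fun_xsection_finite_kernel; rewrite inE.
by apply: eq_measurable_fun => x _; rewrite xsectionE.
Qed.

(** The measure [dm_x(y) dnu(x)] on edges, built as a bind in the Giry monad. *)
Definition joint_law : giry (X * X)%type R :=
  giry_bind (nu : subprobability X R) measurable_edge.

Lemma ge0_integral_joint_law (F : X * X -> \bar R) :
  measurable_fun setT F -> (forall z, 0 <= F z)%E ->
  (\int[joint_law]_z F z = \int[nu]_x \int[m x]_y F (x, y))%E.
Proof.
move=> mF F0; rewrite -/(giry_int joint_law F) giry_int_bind//.
by apply: eq_integral => x _; rewrite giry_int_map.
Qed.

Lemma joint_lawX A B : measurable A -> measurable B ->
  joint_law (A `*` B) = (\int[nu]_(x in A) m x B)%E.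
Proof.
move=> mA mB; rewrite -(setIT (A `*` B)) -integral_indic//; last exact: measurableX.
rewrite ge0_integral_joint_law//; last first.
  by apply/measurable_EFinP; apply: measurable_indic; exact: measurableX.
rewrite [RHS]integral_mkcond; apply: eq_integral => x _ /=.
rewrite patchE; case: ifPn => xA.
  rewrite -[in RHS](setIT B) -integral_indic//; apply: eq_integral => y _.
  by rewrite !indicE in_setX/= xA.
by rewrite integral0_eq// => y _; rewrite indicE in_setX/= (negbTE xA).
Qed.

Let section_integral_measurable (F : X * X -> \bar R) :
  measurable_fun setT F -> (forall z, 0 <= F z)%E ->
  measurable_fun setT (fun x => \int[m x]_y F (x, y))%E.
Proof.
by move=> mF F0; apply: (@measurable_fun_integral_finite_kernel _ _ _ _ _ F k).
Qed.

Let section_integralE (F : X * X -> \bar R) :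
  (fun x => \int[m x]_y F (x, y))%E =
  ((fun x => \int[m x]_y F^\+ (x, y)) \- (fun x => \int[m x]_y F^\- (x, y)))%E.
Proof.
apply/funext => x; rewrite [LHS]integralE.
by congr (_ - _)%E; apply: eq_integral => y _; rewrite !(funeposE, funenegE).
Qed.

Lemma integrable_section (F : X * X -> \bar R) :
    joint_law.-integrable setT F ->
  {ae nu, forall x, (m x).-integrable setT (fun y => F (x, y))}.
Proof.
move=> /integrableP[mF Foo]; have mabs : measurable_fun setT (abse \o F).
  exact: measurableT_comp.
rewrite ge0_integral_joint_law// in Foo.
have : nu.-integrable setT (fun x => \int[m x]_y `|F (x, y)|)%E.
  apply/integrableP; split.
    by apply: (section_integral_measurable (abse \o F)) => // z /=.
  under eq_integral do rewrite gee0_abs ?integral_ge0//.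
  exact: Foo.
move=> /(integrable_ae measurableT); apply: filterS => x /(_ I) xfin.
apply/integrableP; split; first exact: measurable_fun_pair2.
by rewrite ltey_eq xfin.
Qed.

(** Fubini for a kernel: the nonnegative case applies to the positive and negative parts, whose
    section integrals are integrable and can be subtracted. *)
Lemma integral_joint_law (F : X * X -> \bar R) : joint_law.-integrable setT F ->
  nu.-integrable setT (fun x => \int[m x]_y F (x, y))%E /\
  (\int[joint_law]_z F z = \int[nu]_x \int[m x]_y F (x, y))%E.
Proof.
move=> iF; have mF := measurable_int _ iF.
have key G : joint_law.-integrable setT G -> (forall z, 0 <= G z)%E ->
    nu.-integrable setT (fun x => \int[m x]_y G (x, y))%E.
  move=> iG G0; have mG := measurable_int _ iG.
  apply/integrableP; split; first exact: section_integral_measurable.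
  under eq_integral do rewrite gee0_abs ?integral_ge0//.
  by rewrite -ge0_integral_joint_law//; exact: integrable_lty.
have iFp := key _ (integrable_funepos measurableT iF) (funepos_ge0 _).
have iFn := key _ (integrable_funeneg measurableT iF) (funeneg_ge0 _).
rewrite section_integralE; split; first exact: integrableB.
rewrite integralB// [LHS]integralE !ge0_integral_joint_law//.
  exact: measurable_funeneg.
exact: measurable_funepos.
Qed.

Lemma measurable_section_integral (F : X * X -> \bar R) : measurable_fun setT F ->
  measurable_fun setT (fun x => \int[m x]_y F (x, y))%E.
Proof.
move=> mF; rewrite section_integralE.
apply: emeasurable_funB; apply: section_integral_measurable => //.
  exact: measurable_funepos.
exact: measurable_funeneg.
Qed.

Hypothesis nu_reversible : reversible_measure m nu.

(** Reversibility is this symmetry on rectangles, a generating family stable under intersection. *)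
Lemma joint_law_swap A : measurable A ->
  joint_law A = pushforward joint_law (@swap_pair X X) A.
Proof.
pose G := [set A `*` B | A in @measurable _ X & B in @measurable _ X].
have mswap : measurable_fun setT (@swap_pair X X) by exact: measurable_swap.
apply: (@measure_unique _ R _ G (fun=> setT)).
- exact: measurable_prod_measurableType.
- move=> _ _ [X1 mX1 [X2 mX2 <-]] [Y1 mY1 [Y2 mY2 <-]].
  exists (X1 `&` Y1); first exact: measurableI.
  by exists (X2 `&` Y2); [exact: measurableI|rewrite setXI].
- by move=> _; exists setT => //; exists setT => //; rewrite setXTT.
- exact: bigcup_const.
- move=> _ [B mB [C mC <-]].
  apply: (etrans (joint_lawX _ _ mB mC)); rewrite nu_reversible//.
  apply: (etrans (esym (joint_lawX _ _ mC mB))).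
  congr (joint_law _); apply/seteqP; split => -[x y] /=; tauto.
- by move=> _; rewrite ltey_eq fin_num_measure.
Qed.

Lemma ge0_integral_joint_law_swap (F : X * X -> \bar R) :
  measurable_fun setT F -> (forall z, 0 <= F z)%E ->
  (\int[joint_law]_z F z = \int[joint_law]_z F (swap_pair z))%E.
Proof.
move=> mF F0.
have mswap : measurable_fun setT (@swap_pair X X) by exact: measurable_swap.
rewrite (eq_measure_integral (pushforward joint_law (@swap_pair X X))).
  by rewrite ge0_integral_pushforward.
by move=> A mA _; exact: joint_law_swap.
Qed.

Lemma integral_joint_law_swap (F : X * X -> \bar R) :
  joint_law.-integrable setT F ->
  (\int[joint_law]_z F z = \int[joint_law]_z F (swap_pair z))%E.
Proof.
move=> /measurable_int mF.
have mFp := measurable_funepos mF; have mFn := measurable_funeneg mF.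
rewrite [LHS]integralE [RHS]integralE.
rewrite (ge0_integral_joint_law_swap F^\+%E)// (ge0_integral_joint_law_swap F^\-%E)//.
by congr (_ - _)%E; apply: eq_integral => z _; rewrite !(funeposE, funenegE).
Qed.

End joint_law.

(** * Square integrability and Jensen's inequality *)

Lemma Lfun2P {d} {T : measurableType d} {R : realType}
    (mu : {measure set T -> \bar R}) (f : T -> R) :
  f \in Lfun mu 2%:E <->
  measurable_fun setT f /\ (\int[mu]_x (f x ^+ 2)%:E < +oo)%E.
Proof.
split.
  move=> f2; split.
    by move: f2; rewrite inE => /andP[+ _]; rewrite inE.
  exact: (integrable_lty measurableT (Lfun2_integrable_sqr f2)).
move=> [mf f2]; rewrite inE; apply/andP; split; rewrite inE//=.
rewrite /finite_norm unlock poweR_lty//.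
under eq_integral do rewrite /= powR_mulrn// -normrX ger0_norm ?sqr_ge0//.
exact: f2.
Qed.

(** Jensen's inequality, read off from the nonnegativity of the variance. *)
Lemma sqr_integral_le {d} {T : measurableType d} {R : realType}
    (mu : probability T R) (f : T -> R) : measurable_fun setT f ->
  ((fine (\int[mu]_x (f x)%:E) ^+ 2)%:E <= \int[mu]_x (f x ^+ 2)%:E)%E.
Proof.
move=> mf.
have [->|] := eqVneq (\int[mu]_x (f x ^+ 2)%:E)%E +oo%E; first exact: leey.
rewrite -ltey => f2.
have lf : f \in Lfun mu 2%:E by apply/Lfun2P.
have f1 : mu.-integrable setT (EFin \o f).
  apply/Lfun1_integrable; apply: Lfun_subset12 lf; exact: fin_num_measure.
have Ef : (\int[mu]_x (f x)%:E)%E \is a fin_num by exact: integrable_fin_num.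
have := variance_ge0 mu f; rewrite varianceE// unlock.
by rewrite -[X in (_ - X ^+ 2)%E](fineK Ef) -EFin_expe suber_ge0.
Qed.

(** * Completeness of L2 for geometric sequences *)

(* Weighting the increments by [c ^- k] trades the square of a sum of increments
   for a sum of squares. *)
Lemma weighted_telescope_le {R : realFieldType} (a : nat -> R) (c : R) n j :
  0 < c < 1 ->
  (a n - a (n + j)%N) ^+ 2 <=
    c ^+ n / (1 - c) * \sum_(n <= k < n + j) c ^- k * (a k - a k.+1) ^+ 2.
Proof.
move=> /andP[c0 c1]; have c1' : 0 < 1 - c by rewrite subr_gt0.
elim: j n => [|j IHj] n.
  by rewrite addn0 subrr expr0n/= big_geq// mulr0.
rewrite big_ltn ?addnS ?ltnS ?leq_addr// -addSn.
have := IHj n.+1; set S := \sum_(_ <= _ < _) _; set t := _ - _ => tS.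
have -> : a n - a (n.+1 + j)%N = (a n - a n.+1) + t by rewrite /t addrA subrK.
set d := a n - a n.+1.
(* Convexity of the square with weights [1 - c] and [c]. *)
apply: (@le_trans _ _ (d ^+ 2 / (1 - c) + t ^+ 2 / c)).
  rewrite -subr_ge0 [leRHS](_ : _ = (c * d - (1 - c) * t) ^+ 2 / (c * (1 - c))).
    by rewrite divr_ge0 ?sqr_ge0// mulr_ge0 ?ltW.
  by field; rewrite !gt_eqF.
have -> : c ^+ n / (1 - c) * (c ^- n * d ^+ 2 + S) =
    d ^+ 2 / (1 - c) + c ^+ n.+1 / (1 - c) * S / c.
  by rewrite (exprS c n); field; rewrite !gt_eqF// exprn_gt0.
by rewrite lerD2l ler_pM2r ?invr_gt0.
Qed.

Lemma cvg_weighted_increments {R : realType} (a : nat -> R) (c M : R) :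
  0 < c < 1 ->
  (forall n, \sum_(0 <= k < n) c ^- k * (a k - a k.+1) ^+ 2 <= M) ->
  exists b, a n @[n --> \oo] --> b /\
    forall n, (a n - b) ^+ 2 <= c ^+ n / (1 - c) * M.
Proof.
move=> c01 aM; have /andP[c0 c1] := c01.
have term_ge0 k : 0 <= c ^- k * (a k - a k.+1) ^+ 2.
  by rewrite mulr_ge0 ?sqr_ge0// invr_ge0 exprn_ge0// ltW.
have M0 : 0 <= M by have := aM 0%N; rewrite big_geq.
have anm n j : (a n - a (n + j)%N) ^+ 2 <= c ^+ n / (1 - c) * M.
  apply: le_trans (weighted_telescope_le _ _ _ _ c01) _.
  apply: ler_wpM2l; first by rewrite divr_ge0 ?exprn_ge0 ?subr_ge0 ?ltW.
  apply: le_trans (aM (n + j)%N).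
  by rewrite (@big_cat_nat _ _ _ n 0)//= ?leq_addr// lerDr sumr_ge0.
have rate0 : c ^+ n / (1 - c) * M @[n --> \oo] --> 0.
  have : M / (1 - c) * c ^+ n @[n --> \oo] --> (M / (1 - c) * 0 : R).
    by apply: cvgMl_tmp; apply: cvg_expr; rewrite ger0_norm// ltW.
  by rewrite mulr0; under eq_fun do rewrite mulrC mulrA mulrAC.
have : cvg (a n @[n --> \oo]).
  apply/cauchy_cvgP/cauchy_exP => e e0.
  have /cvgr_lt /(_ (e ^+ 2)) := rate0.
  rewrite exprn_gt0// => /(_ isT) [N _ rateN].
  exists (a N); exists N => // m /= Nm.
  rewrite /ball/= -(ltr_pXn2r (ltn0Sn 1)) ?nnegrE ?(ltW e0)// -normrX.
  rewrite ger0_norm ?sqr_ge0// -(subnKC Nm).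
  by apply: le_lt_trans (anm _ _) _; apply: rateN => /=.
move=> /cvg_ex[b ab]; exists b; split=> // n.
have : (a n - a m) ^+ 2 @[m --> \oo] --> (a n - b) ^+ 2.
  by rewrite expr2; apply: cvgM; apply: cvgB => //; exact: cvg_cst.
move/cvgr_to_le; apply; exists n => // m /= nm.
by rewrite -(subnKC nm).
Qed.

Lemma geometric_sum_le {R : realFieldType} (q : R) n : 0 <= q < 1 ->
  \sum_(0 <= k < n) q ^+ k <= (1 - q)^-1.
Proof.
move=> /andP[q0 q1]; have q1' : 0 < 1 - q by rewrite subr_gt0.
rewrite -(ler_pM2l q1') mulfV ?gt_eqF// big_mkord.
have := subrX1 q n; have := exprn_ge0 n q0; lra.
Qed.

Lemma Lfun2B {d} {T : measurableType d} {R : realType}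
    (mu : {measure set T -> \bar R}) (f g : T -> R) :
  f \in Lfun mu 2%:E -> g \in Lfun mu 2%:E -> f \- g \in Lfun mu 2%:E.
Proof.
move=> f2 g2; have p1 : (1 <= 2%:E :> \bar R)%E by rewrite lee_fin ler1n.
by have /(_ p1) := rpredB f2 g2.
Qed.

Lemma Lfun2_integrableM {d} {T : measurableType d} {R : realType}
    (mu : {measure set T -> \bar R}) (f g : T -> R) :
  f \in Lfun mu 2%:E -> g \in Lfun mu 2%:E ->
  mu.-integrable setT (EFin \o (fun x => f x * g x)).
Proof. by move=> f2 g2; apply/Lfun1_integrable/Lfun2_mul_Lfun1. Qed.

(** The weighted sum [s] of squared increments has finite integral. Where [s] is finite the sequence
    converges with squared error at most a multiple of [c ^+ n * s], and integrating this rate gives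
    [L2] convergence. *)
Lemma Lfun2_geometric_complete {d} {T : measurableType d} {R : realType}
    (mu : {measure set T -> \bar R}) (u : nat -> T -> R) (C r : R) :
    0 < r < 1 -> (forall n, u n \in Lfun mu 2%:E) ->
    (forall n, \int[mu]_x ((u n x - u n.+1 x) ^+ 2)%:E <= (C * r ^+ n)%:E)%E ->
  exists v, exists K, exists c, [/\ v \in Lfun mu 2%:E, 0 < c < 1 &
    forall n, (\int[mu]_x ((u n x - v x) ^+ 2)%:E <= (K * c ^+ n)%:E)%E].
Proof.
(* Any [c] strictly between [r] and 1 works: [r / c < 1] bounds the integral of [s], and [c < 1]
   gives the rate. *)
move=> r01 u2 uC; pose c := (1 + r) / 2.
have c01 : 0 < c < 1 by rewrite /c; lra.
have rc : 0 <= r / c < 1.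
  by rewrite divr_ge0 ?ltr_pdivrMr ?/c; lra.
have /andP[c0 c1] := c01.
have mu_ n : measurable_fun setT (u n) by have /Lfun2P[] := u2 n.
pose w k x := c ^- k * (u k x - u k.+1 x) ^+ 2.
have w0 k x : 0 <= w k x.
  by rewrite mulr_ge0 ?sqr_ge0// invr_ge0 exprn_ge0// ltW.
have mw k : measurable_fun setT (EFin \o w k).
  apply/measurable_EFinP/measurable_funM => //.
  exact/measurable_funX/measurable_funB.
pose s x := (\sum_(k <oo) (w k x)%:E)%E.
have ms : measurable_fun setT s.
  apply: (ge0_emeasurable_sum (h := fun k x => (w k x)%:E) (P := xpredT)).
    by move=> k x _ _; rewrite lee_fin.
  by move=> k _; exact: mw.
have C0 : 0 <= C.
  have := uC 0%N; rewrite expr0 mulr1 -lee_fin; apply: le_trans.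
  by apply: integral_ge0 => x _; rewrite lee_fin sqr_ge0.
pose K0 := C / (1 - r / c).
have sK0 : (\int[mu]_x s x <= K0%:E)%E.
  rewrite integral_nneseries//; last by move=> k x _; rewrite lee_fin.
  apply: lime_le.
    by apply: is_cvg_nneseries => k _ _; apply: integral_ge0 => x _; rewrite lee_fin.
  apply: nearW => n.
  apply: (@le_trans _ _ (\sum_(0 <= k < n) (C * (r / c) ^+ k)%:E)%E).
    apply: lee_sum => k _.
    under eq_integral do rewrite EFinM.
    rewrite ge0_integralZl_EFin//.
    - have -> : C * (r / c) ^+ k = c ^- k * (C * r ^+ k).
        by rewrite expr_div_n; ring.
      rewrite EFinM lee_wpmul2l//.
      by rewrite lee_fin invr_ge0 exprn_ge0// ltW.
    - by move=> x _; rewrite lee_fin sqr_ge0.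
    - exact/measurable_EFinP/measurable_funX/measurable_funB.
    - by rewrite invr_ge0 exprn_ge0// ltW.
  by rewrite sumEFin lee_fin -mulr_sumr ler_wpM2l// geometric_sum_le.
(* Cutting off to [D] makes the sequence converge everywhere, so its limit is measurable; off [D]
   the rate is trivial because [s] is [+oo]. *)
pose D := [set x | (s x < +oo)%E].
have mD : measurable D by rewrite -[D]setTI; exact: emeasurable_fun_infty_o.
pose h n x := u n x * \1_D x.
have mh n : measurable_fun setT (h n).
  by apply: measurable_funM => //; exact: measurable_indic.
have limh x : exists b : R, h n x @[n --> \oo] --> b /\
    (D x -> forall n, (u n x - b) ^+ 2 <= c ^+ n / (1 - c) * fine (s x)).
  have [Dx|nDx] := pselect (D x); last first.
    exists 0; split=> //; rewrite /h; under eq_fun do rewrite indicE memNset// mulr0.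
    exact: cvg_cst.
  have [n|b [ub bP]] :=
      cvg_weighted_increments (fun n => u n x) c (fine (s x)) c01.
    rewrite -lee_fin -sumEFin fineK; last first.
      by rewrite ge0_fin_numE// nneseries_ge0// => k _ _; rewrite lee_fin.
    by apply: nneseries_lim_ge => k _ _; rewrite lee_fin; exact: w0.
  exists b; split=> //; rewrite /h.
  by under eq_fun do rewrite indicE mem_set// mulr1.
have [v vP] := choice limh.
have mv : measurable_fun setT v.
  by apply: (measurable_fun_cvg (h := h)) => // x _; have [] := vP x.
have vK n : (\int[mu]_x ((u n x - v x) ^+ 2)%:E <= (K0 / (1 - c) * c ^+ n)%:E)%E.
  apply: (@le_trans _ _ (\int[mu]_x ((c ^+ n / (1 - c))%:E * s x)))%E.
    apply: ge0_le_integral => //.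
    - by move=> x _; rewrite lee_fin sqr_ge0.
    - exact/measurable_EFinP/measurable_funX/measurable_funB.
    - exact: measurable_funeM.
    - move=> x _; have [Dx|nDx] := pselect (D x).
        have [_ /(_ Dx n)] := vP x; rewrite -lee_fin [leRHS]EFinM fineK//.
        by rewrite ge0_fin_numE// nneseries_ge0// => k _ _; rewrite lee_fin.
      have -> : s x = +oo%E by move/negP : nDx; rewrite /= -leNgt leye_eq => /eqP.
      by rewrite gt0_muley ?leey// lte_fin divr_gt0 ?exprn_gt0 ?subr_gt0.
  rewrite ge0_integralZl_EFin//.
  - have -> : K0 / (1 - c) * c ^+ n = c ^+ n / (1 - c) * K0 by ring.
    rewrite [leRHS]EFinM lee_wpmul2l// lee_fin.
    by rewrite divr_ge0 ?exprn_ge0 ?subr_ge0 ?ltW.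
  - by move=> x _; rewrite nneseries_ge0// => k _ _; rewrite lee_fin.
  - by rewrite divr_ge0 ?exprn_ge0 ?subr_ge0 ?ltW.
exists v, (K0 / (1 - c)), c; split=> //.
have uv : u 0%N \- v \in Lfun mu 2%:E.
  apply/Lfun2P; split; first exact: measurable_funB.
  by apply: le_lt_trans (vK 0%N) _; rewrite ltry.
have -> : v = u 0%N \- (u 0%N \- v).
  by apply/funext => x /=; rewrite opprB addrC subrK.
exact: Lfun2B.
Qed.

(** * The Laplacian on L2 *)

Section laplacian.
Context {R : realType} {d : measure_display} {X : measurableType d}.
Variables (m : X -> probability X R) (nu : probability X R).
Hypothesis m_measurable : forall A, measurable A ->
  measurable_fun [set: X] (fun x => (m x A : \bar R)).
Hypothesis nu_reversible : reversible_measure m nu.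

Let P := joint_law m nu m_measurable.

(** The first marginal of the joint law is [nu], each [m x] having mass one. *)
Lemma Lfun2_fst f : f \in Lfun nu 2%:E -> f \o fst \in Lfun P 2%:E.
Proof.
move=> /Lfun2P[mf f2]; apply/Lfun2P; split; first exact: measurableT_comp.
rewrite ge0_integral_joint_law//=.
- apply: le_lt_trans f2; rewrite le_eqVlt; apply/orP; left; apply/eqP.
  apply: eq_integral => x _.
  rewrite (integral_cst (m x) measurableT (f x ^+ 2)%:E).
  by rewrite [X in (_ * X)%E](_ : _ = 1%E) ?mule1//; exact: probability_setT.
- exact/measurable_EFinP/measurable_funX/measurableT_comp.
- by move=> z; rewrite lee_fin sqr_ge0.
Qed.

Lemma Lfun2_snd f : f \in Lfun nu 2%:E -> f \o snd \in Lfun P 2%:E.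
Proof.
move=> f2; have /Lfun2P[mf1 f12] := Lfun2_fst _ f2; have /Lfun2P[mf _] := f2.
apply/Lfun2P; split; first exact: measurableT_comp.
rewrite ge0_integral_joint_law_swap//.
- exact/measurable_EFinP/measurable_funX/measurableT_comp.
- by move=> z; rewrite lee_fin sqr_ge0.
Qed.

Definition grad (f : X -> R) (z : X * X) : R := f z.2 - f z.1.

Lemma Lfun2_grad f : f \in Lfun nu 2%:E -> grad f \in Lfun P 2%:E.
Proof. by move=> f2; apply: Lfun2B; [exact: Lfun2_snd|exact: Lfun2_fst]. Qed.

Lemma measurable_lapm f : measurable_fun setT f -> measurable_fun setT (lapm m f).
Proof.
move=> mf; have mg : measurable_fun setT (EFin \o grad f).
  by apply/measurable_EFinP/measurable_funB; exact: measurableT_comp.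
have mG := measurable_section_integral _ m_measurable _ mg.
have mfine : measurable_fun setT (@fine R) by exact: fine_measurable.
exact: (measurableT_comp mfine mG).
Qed.

Lemma HmE f : measurable_fun setT f ->
  (Hm m nu f = (2^-1)%:E * \int[P]_z (grad f z ^+ 2)%:E)%E.
Proof.
move=> mf; rewrite /Hm ge0_integral_joint_law//.
- apply/measurable_EFinP/measurable_funX/measurable_funB; exact: measurableT_comp.
- by move=> z; rewrite lee_fin sqr_ge0.
Qed.

Lemma lapm_sqr_le f : measurable_fun setT f ->
  (\int[nu]_x (lapm m f x ^+ 2)%:E <= \int[P]_z (grad f z ^+ 2)%:E)%E.
Proof.
move=> mf; have mg : measurable_fun setT (grad f).
  by apply/measurable_funB; exact: measurableT_comp.
have mg2 : measurable_fun setT (fun z => (grad f z ^+ 2)%:E).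
  exact/measurable_EFinP/measurable_funX.
rewrite ge0_integral_joint_law//; last by move=> z; rewrite lee_fin sqr_ge0.
apply: ge0_le_integral => //.
- by move=> x _; rewrite lee_fin sqr_ge0.
- exact/measurable_EFinP/measurable_funX/measurable_lapm.
- exact: (measurable_section_integral m m_measurable _ mg2).
- move=> x _; apply: (sqr_integral_le (m x) (fun y => grad f (x, y))).
  exact: measurable_fun_pair2.
Qed.

Lemma lapm_Lfun2 f : f \in Lfun nu 2%:E -> (fun x => - lapm m f x) \in Lfun nu 2%:E.
Proof.
move=> f2; have /Lfun2P[mf _] := f2; have /Lfun2P[_ g2] := Lfun2_grad _ f2.
apply/Lfun2P; split; first exact/measurable_funN/measurable_lapm.
under eq_integral do rewrite sqrrN.
exact: le_lt_trans (lapm_sqr_le _ mf) g2.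
Qed.

Lemma lapm_grad_fst f g : f \in Lfun nu 2%:E -> g \in Lfun nu 2%:E ->
  \int[nu]_x (lapm m f x * g x) = \int[P]_z (grad f z * g z.1).
Proof.
move=> f2 g2; have /Lfun2P[mf _] := f2; have /Lfun2P[mg _] := g2.
have gradf2 := Lfun2_grad _ f2.
have iF := Lfun2_integrableM P _ _ gradf2 (Lfun2_fst _ g2).
have igrad : P.-integrable setT (EFin \o grad f).
  by apply/Lfun1_integrable; apply: Lfun_subset12 gradf2; exact: fin_num_measure.
rewrite /Rintegral; congr fine.
have [iG ->] := integral_joint_law _ _ _ _ iF.
apply: ae_eq_integral => //.
- exact/measurable_EFinP/measurable_funM/mg/measurable_lapm.
- exact: measurable_int iG.
(* The [fine] in [lapm] returns the true integral where the section of the gradient is integrable,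
   hence almost everywhere. *)
apply: filterS (integrable_section _ _ _ _ igrad) => x ix _.
rewrite /= -[RHS]/(\int[m x]_y (grad f (x, y) * g x)%:E)%E.
under [RHS]eq_integral do rewrite EFinM.
rewrite integralZr// EFinM; congr (_ * _)%E.
by rewrite fineK//; exact: integrable_fin_num ix.
Qed.

(** Integration by parts: swapping the ends of an edge preserves the joint law and reverses
    [grad f], so the two terms of [grad g] contribute equally. *)
Lemma lapm_grad f g : f \in Lfun nu 2%:E -> g \in Lfun nu 2%:E ->
  \int[nu]_x (- lapm m f x * g x) = 2^-1 * \int[P]_z (grad f z * grad g z).
Proof.
move=> f2 g2; have gradf2 := Lfun2_grad _ f2.
have i1 := Lfun2_integrableM P _ _ gradf2 (Lfun2_fst _ g2).
have i2 := Lfun2_integrableM P _ _ gradf2 (Lfun2_snd _ g2).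
have -> : \int[P]_z (grad f z * grad g z) =
    \int[P]_z (grad f z * g z.2) - \int[P]_z (grad f z * g z.1).
  by rewrite -RintegralB//; apply: eq_Rintegral => z _; rewrite -mulrBr.
have -> : \int[P]_z (grad f z * g z.2) = - \int[P]_z (grad f z * g z.1).
  rewrite /Rintegral integral_joint_law_swap//.
  rewrite -/(Rintegral P setT (fun z => grad f (swap_pair z) * g z.1)).
  rewrite -mulN1r -RintegralZl//; apply: eq_Rintegral => z _.
  by rewrite /grad /=; ring.
rewrite -lapm_grad_fst//.
have -> : \int[nu]_x (lapm m f x * g x) = - \int[nu]_x (- lapm m f x * g x).
  rewrite -mulN1r -RintegralZl//; last first.
    exact: Lfun2_integrableM (lapm_Lfun2 _ f2) g2.
  by apply: eq_Rintegral => x _; ring.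
by rewrite opprK; field.
Qed.

End laplacian.

(** * [L2] as a semi-inner product space *)

Section L2_space.
Context {R : realType} {d : measure_display} {X : measurableType d}.
Variable nu : probability X R.

Let V := LfunType nu (lee1n 2).

(** Elements of [V] are functions, not classes modulo null sets, so this form is only
    semi-definite. *)
Definition L2ip (f g : V) : R := \int[nu]_x (f x * g x).

Definition L2one : V := Lfun_Sub (lee1n 2) (Lfun_cst nu 1 2).

Lemma L2ip_integrable (f g : V) :
  nu.-integrable setT (EFin \o (fun x => f x * g x)).
Proof. exact: (Lfun2_integrableM nu _ _ (LfunP f) (LfunP g)). Qed.

Lemma L2ipC f g : L2ip f g = L2ip g f.
Proof. by apply: eq_Rintegral => x _; rewrite mulrC. Qed.

Lemma L2ipZDl a f g h : L2ip (a *: f + g) h = a * L2ip f h + L2ip g h.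
Proof.
rewrite /L2ip -RintegralZl//; last exact: L2ip_integrable.
rewrite -RintegralD//.
- by apply: eq_Rintegral => x _ /=; rewrite mulrDl mulrA.
- have := L2ip_integrable (a *: f) h; apply: eq_integrable => // x _ /=.
  by rewrite mulrA.
- exact: L2ip_integrable.
Qed.

Lemma L2ip_ge0 f : 0 <= L2ip f f.
Proof. by apply: Rintegral_ge0 => x _; rewrite -expr2 sqr_ge0. Qed.

Lemma L2ip_sqrE (f : V) : (\int[nu]_x (f x ^+ 2)%:E)%E = (L2ip f f)%:E.
Proof.
rewrite /L2ip /Rintegral fineK; first by apply: eq_integral => x _; rewrite expr2.
by apply: integrable_fin_num => //; exact: L2ip_integrable.
Qed.

Lemma L2ip11 : L2ip L2one L2one = 1.
Proof.
have -> : L2ip L2one L2one = \int[nu]_x 1.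
  by apply: eq_Rintegral => x _ /=; rewrite mulr1.
rewrite Rintegral_cst// mul1r [X in fine X](_ : _ = 1%E)//.
exact: probability_setT.
Qed.

Lemma L2ip_geometric_complete (u : nat -> V) (C r : R) : 0 < r < 1 ->
  (forall n, L2ip (u n - u n.+1) (u n - u n.+1) <= C * r ^+ n) ->
  exists v, L2ip (u n - v) (u n - v) @[n --> \oo] --> 0.
Proof.
move=> r01 uC.
have [n|n|v [K [c [v2 c01 vK]]]] :=
    Lfun2_geometric_complete nu (fun n => u n) C r r01.
- exact: LfunP.
- by have := L2ip_sqrE (u n - u n.+1) => ->; rewrite lee_fin.
exists (Lfun_Sub (lee1n 2) v2).
apply: (@squeeze_cvgr _ _ _ _ (fun=> 0) (fun n => K * c ^+ n)).
- near=> n; rewrite L2ip_ge0 -lee_fin -L2ip_sqrE; exact: vK.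
- exact: cvg_cst.
- rewrite -[X in _ --> X](mulr0 K); apply: cvgMl_tmp.
  by apply: cvg_expr; rewrite ger0_norm; case/andP: c01 => // /ltW.
Unshelve. all: by end_near. Qed.

Lemma VarE (f : V) : Var nu f = (L2ip f f - L2ip f L2one ^+ 2)%:E.
Proof.
rewrite /Var; have -> : mean nu f = L2ip f L2one.
  by rewrite /mean; apply: eq_Rintegral => x _ /=; rewrite mulr1.
have -> : ((L2ip f f - L2ip f L2one ^+ 2) =
    L2ip (f - L2ip f L2one *: L2one) (f - L2ip f L2one *: L2one)).
  by rewrite (ip_subZ _ L2ipC L2ipZDl) L2ip11; ring.
rewrite -L2ip_sqrE; apply: eq_integral => x _.
by rewrite -[RHS]/(((f x - L2ip f L2one * 1) ^+ 2)%:E) mulr1.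
Qed.

End L2_space.

(** * The negative Laplacian as an operator on [L2] *)

Section laplacian_operator.
Context {R : realType} {d : measure_display} {X : measurableType d}.
Variables (m : X -> probability X R) (nu : probability X R).
Hypothesis m_measurable : forall A, measurable A ->
  measurable_fun [set: X] (fun x => (m x A : \bar R)).
Hypothesis nu_reversible : reversible_measure m nu.

Let V := LfunType nu (lee1n 2).

Definition L2lap (f : V) : V :=
  Lfun_Sub (lee1n 2) (lapm_Lfun2 m nu m_measurable nu_reversible f (LfunP f)).

Local Notation A := L2lap.
Local Notation ip := (L2ip nu).

Lemma L2lapE f g : ip (A f) g =
  2^-1 * \int[joint_law m nu m_measurable]_z (grad f z * grad g z).
Proof. by apply: lapm_grad => //; exact: LfunP. Qed.

Lemma L2lapA f g : ip (A f) g = ip f (A g).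
Proof.
rewrite (L2ipC _ f) !L2lapE; congr (_ * _).
by apply: eq_Rintegral => z _; rewrite mulrC.
Qed.

Lemma HmL2E (f : V) : Hm m nu f = (ip (A f) f)%:E.
Proof.
have f2 := LfunP f; have /Lfun2P[mf _] := f2.
rewrite (HmE _ _ m_measurable)// L2lapE EFinM; congr (_ * _)%E.
have := Lfun2_grad m nu m_measurable nu_reversible _ f2 => g2.
have ig := Lfun2_integrableM _ _ _ g2 g2.
by rewrite /Rintegral fineK//; exact: integrable_fin_num.
Qed.

Lemma L2lap_sqrE (f : V) :
  (\int[nu]_x ((- lapm m f x) ^+ 2)%:E)%E = (ip (A f) (A f))%:E.
Proof. exact: (L2ip_sqrE nu (A f)). Qed.

(** Jensen's inequality for each [m x] bounds [|A f|^2] by the integral of the squared gradient,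
    which is twice [Hm]. *)
Lemma L2lap_sqr_le f : ip (A f) (A f) <= 2 * ip (A f) f.
Proof.
rewrite -lee_fin EFinM -HmL2E -L2lap_sqrE.
have /Lfun2P[mf _] := LfunP f.
rewrite (HmE _ _ m_measurable)// muleA -EFinM mulfV// mul1e.
under eq_integral do rewrite sqrrN.
exact: lapm_sqr_le.
Qed.

Lemma L2lap1 : A (L2one nu) = 0.
Proof.
apply/LfuneqP => x /=; rewrite /lapm.
by under eq_integral do rewrite subrr; rewrite integral0 oppr0.
Qed.

Hypothesis nu_ergodic : ergodic m nu.

Lemma L2lap_ker (f : V) : ip (A f) (A f) = 0 ->
  exists c, ip (f - c *: L2one nu) (f - c *: L2one nu) = 0.
Proof.
move=> Af0; have /Lfun2P[mf f2] := LfunP f.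
have mA : measurable_fun setT (fun x => ((- lapm m f x) ^+ 2)%:E).
  apply/measurable_EFinP/measurable_funX/measurable_funN.
  exact: measurable_lapm m_measurable _ mf.
have lap0 : {ae nu, forall x, lapm m f x = 0}.
  have /(ae_eq_integral_abs nu measurableT mA) :
    (\int[nu]_x `|((- lapm m f x) ^+ 2)%:E| = 0)%E.
    under eq_integral do rewrite gee0_abs ?lee_fin ?sqr_ge0//.
    by rewrite L2lap_sqrE Af0.
  apply: filterS => x /(_ I) [] /eqP.
  by rewrite sqrf_eq0 oppr_eq0 => /eqP.
have [c fc] := nu_ergodic f (conj mf f2) lap0.
exists c; apply/EFin_inj; rewrite -L2ip_sqrE.
rewrite (ae_eq_integral (cst 0)%E) ?integral0//.
- apply/measurable_EFinP/measurable_funX.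
  by have /Lfun2P[] := LfunP (f - c *: L2one nu).
- apply: filterS fc => x fx _.
  by rewrite -[LHS]/(((f x - c * 1) ^+ 2)%:E) fx mulr1 subrr expr0n.
Qed.

(** The two abstract implications with the constant 1 as [e]; ergodicity and completeness enter in
    the converse. *)
Lemma gap_le_iff l : 0 <= l ->
  (forall f : V, (l%:E * Var nu f <= Hm m nu f)%E) <->
  (forall f : V, (l%:E * Hm m nu f <= \int[nu]_x ((- lapm m f x) ^+ 2)%:E)%E).
Proof.
move=> l0; split=> h f.
  rewrite HmL2E L2lap_sqrE -EFinM lee_fin.
  apply: (poincare_laplacian _ (L2ipC nu) (L2ipZDl nu) (L2ip_ge0 nu) A L2lapA
    L2lap_sqr_le _ (L2ip11 nu) L2lap1 _ l0) => u.
  by have := h u; rewrite VarE HmL2E -EFinM lee_fin.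
rewrite VarE HmL2E -EFinM lee_fin.
apply: (laplacian_poincare _ (L2ipC nu) (L2ipZDl nu) (L2ip_ge0 nu) A L2lapA
    L2lap_sqr_le _ (L2ip11 nu) L2lap1 L2lap_ker (L2ip_geometric_complete nu)
    _ l0) => u.
by have := h u; rewrite HmL2E L2lap_sqrE -EFinM lee_fin.
Qed.

End laplacian_operator.

(** * The spectral gap as the best Poincaré constant *)

Lemma le_gap_iff {R : realType} {d : measure_display} {X : measurableType d}
    (m : X -> probability X R) (nu : probability X R)
    (m_measurable : forall A, measurable A ->
      measurable_fun [set: X] (fun x => (m x A : \bar R)))
    (nu_reversible : reversible_measure m nu) (l : R) :
  (l%:E <= gap m nu)%E <->
  forall f : LfunType nu (lee1n 2), (l%:E * Var nu f <= Hm m nu f)%E.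
Proof.
have quotient (f : LfunType nu (lee1n 2)) : Var nu f <> 0%E ->
    (l%:E <= Hm m nu f * ((fine (Var nu f))^-1)%:E)%E =
    (l%:E * Var nu f <= Hm m nu f)%E.
  have Vge0 : (0 <= Var nu f)%E.
    by apply: integral_ge0 => x _; rewrite lee_fin sqr_ge0.
  move=> /eqP; rewrite (HmL2E _ _ m_measurable nu_reversible) VarE in Vge0 *.
  rewrite eqe => V0; rewrite -!EFinM !lee_fin ler_pdivlMr//.
  by rewrite lt_neqAle eq_sym V0 -lee_fin.
split=> [lgap f|lVar].
  (* Functions of zero variance are left out of the infimum; for them the inequality reads
     [0 <= Hm]. *)
  have [->|/eqP V0] := eqVneq (Var nu f) 0%E.
    rewrite mule0 mule_ge0 ?lee_fin ?invr_ge0//.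
    apply: integral_ge0 => x _; apply: integral_ge0 => y _.
    by rewrite lee_fin sqr_ge0.
  rewrite -quotient//; apply: le_trans lgap _; apply: ereal_inf_lbound.
  by exists f => //; split=> //; apply/Lfun2P/LfunP.
apply/ereal_infP => _ [f [f2 V0] <-].
have fV : f \in Lfun nu 2%:E by apply/Lfun2P.
by have := quotient (Lfun_Sub (lee1n 2) fV) V0 => ->; exact: lVar.
Qed.

Theorem theorem3p17 (R : realType) (d : measure_display) (X : measurableType d)
  (dist : X -> X -> R) (m : X -> probability X R) (nu : probability X R) :
  metric_random_walk_space dist m ->
  invariant_measure m nu ->
  reversible_measure m nu ->
  ergodic m nu ->
  gap m nu =
  ereal_sup [set l%:E | l in [set l : R | 0 <= l /\
     forall f : X -> R, L2 nu f ->
       (l%:E * Hm m nu f <= \int[nu]_x ((- lapm m f x) ^+ 2)%:E)%E]].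
Proof.
move=> [_ _ mm _] _ rev erg; set S := [set l : R | _].
(* [S] is thus the set of nonnegative reals up to the gap, and only its supremum remains to be
   found. *)
have SE l : S l <-> 0 <= l /\ (l%:E <= gap m nu)%E.
  split=> -[l0 lP]; split=> //.
    apply/(le_gap_iff _ _ mm rev)/(gap_le_iff _ _ mm rev erg _ l0) => f.
    by apply: lP; apply/Lfun2P/LfunP.
  move=> f f2; have fV : f \in Lfun nu 2%:E by apply/Lfun2P.
  move/(le_gap_iff _ _ mm rev)/(gap_le_iff _ _ mm rev erg _ l0) : lP.
  exact: (fun h => h (Lfun_Sub (lee1n 2) fV)).
have gap0 : (0 <= gap m nu)%E.
  apply/(le_gap_iff _ _ mm rev) => f; rewrite mul0e mule_ge0 ?lee_fin ?invr_ge0//.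
  apply: integral_ge0 => x _; apply: integral_ge0 => y _.
  by rewrite lee_fin sqr_ge0.
apply/eqP; rewrite eq_le; apply/andP; split; last first.
  by apply: ge_ereal_sup => _ [l /SE[_ lgap] <-].
have Ssup l : 0 <= l -> (l%:E <= gap m nu)%E -> (l%:E <= ereal_sup (EFin @` S))%E.
  by move=> l0 lgap; apply: ereal_sup_ubound; exists l => //; apply/SE.
(* A finite gap lies in [S]. The gap is [+oo] when no function has nonzero variance; [S] then holds
   every nonnegative real, and [Num.max t 0] exceeds any given [t]. *)
case: (gap m nu) gap0 Ssup => [g|//|//] g0 Ssup; first exact: Ssup.
rewrite leye_eq; apply/eqP/eq_infty => t.
apply: (@le_trans _ _ (Num.max t 0)%:E); first by rewrite lee_fin le_max lexx.
by apply: Ssup; rewrite ?leey// le_max lexx orbT.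
Qed.
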